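(* Let $\mathcal{D}$ be a domain in a Banach space $X$ and let $\mathcal{F}=\{F_t\}_{t\ge0}\subset C^1(\mathcal{D})$ be a $T$-continuous one-parameter continuous semigroup on $\mathcal{D}$ such that the family of Fréchet derivatives $\{F_t'\}_{t\ge0}$ is $T$-continuous. Then the limit (in the norm of $X$) \[ f(x)=\lim_{t\to0^+}\frac1t\bigl(F_t(x)-x\bigr) \] exists for all $x\in\mathcal{D}$, uniformly on subsets that lie strictly inside $\mathcal{D}$.
   Context: $X$ is a real or complex Banach space. A domain is a connected open set. $C(\mathcal{D},Y)$ is the set of continuous mappings from $\mathcal{D}$ to a Banach space $Y$; $C(\mathcal{D})$ (respectively $C^1(\mathcal{D})$) is the set of continuous (respectively smooth, i.e. continuously Fréchet differentiable) self-mappings of $\mathcal{D}$. The derivatives $F_t'$ are regarded as mappings from $\mathcal{D}$ into the Banach space $L(X)$ of bounded linear operators on $X$ with the operator norm. A bounded subset $\hat{\mathcal{D}}\subset\mathcal{D}$ lies strictly inside $\mathcal{D}$ if $\inf_{x\in\hat{\mathcal{D}}}\operatorname{dist}(x,\partial\mathcal{D})>0$ (with distance to the empty set being $+\infty$). A family $\{f_t\}_{t\ge0}\subset C(\mathcal{D},Y)$ is jointly continuous if for every $(t_0,x_0)\in[0,\infty)\times\mathcal{D}$ one has $\lim_{t\to t_0,\,x\to x_0}f_t(x)=f_{t_0}(x_0)$. It is $T$-continuous (locally uniformly continuous) if for every $t_0\ge0$ and every subset $\hat{\mathcal{D}}$ strictly inside $\mathcal{D}$, $\sup_{x\in\hat{\mathcal{D}}}\|f_t(x)-f_{t_0}(x)\|\to0$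 as $t\to t_0$. A one-parameter continuous semigroup (semigroup) on $\mathcal{D}$ is a jointly continuous family $\{F_t\}_{t\ge0}\subset C(\mathcal{D})$ such that $F_{t+s}=F_t\circ F_s$ for all $t,s\ge0$ and $\lim_{t\to0^+}F_t(x)=x$ for all $x\in\mathcal{D}$. *)

(* Defs.v *)
From HB Require Import structures.
From mathcomp Require Import all_boot all_order all_algebra.
From mathcomp Require Import complex.
From mathcomp Require Import all_classical all_reals all_analysis.

Set Implicit Arguments.
Unset Strict Implicit.
Unset Printing Implicit Defensive.

Import Order.TTheory GRing.Theory Num.Theory.
Import numFieldNormedType.Exports.

Local Open Scope classical_set_scope.
Local Open Scope ring_scope.

Variant scalars := RealScalars | ComplexScalars.

Section Scalars.
Variable R : realType.

Definition scalar_field (s : scalars) : numFieldType :=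
  match s with
  | RealScalars => R
  | ComplexScalars => R[i]
  end.

Definition scalar_of_real (s : scalars) : R -> scalar_field s :=
  match s with
  | RealScalars => fun a => a
  | ComplexScalars => fun a => real_complex R a
  end.

Definition real_of_scalar (s : scalars) : scalar_field s -> R :=
  match s with
  | RealScalars => fun a => a
  | ComplexScalars => fun a => complex.Re a
  end.

End Scalars.
Arguments scalar_of_real {R} s _.
Arguments real_of_scalar {R} s _.

Section Banach.
Variables (R : realType) (s : scalars).
Variable X : completeNormedModType (scalar_field R s).

(* [`|x|] lives in the scalar field (it is a nonnegative real element of
   [R[i]] in the complex case); [rnorm x] is the same number, seen in [R]. *)
Definition rnorm (x : X) : R := real_of_scalar s `|x|.

Definition edist_norm (x y : X) : \bar R := (rnorm (x - y))%:E.

(* Intended for linear [A]; it is [+oo] when [A] is unbounded. *)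
Definition opnorm (A : X -> X) : \bar R :=
  ereal_sup [set (rnorm (A v))%:E | v in [set v : X | rnorm v <= 1]].

Definition edist_op (A B : X -> X) : \bar R := opnorm (A \- B).

Definition domain (D : set X) : Prop := open D /\ connected D.

Definition frontier (D : set X) : set X := closure D `\` interior D.

(* [ereal_inf set0 = +oo], so the distance to an empty set is [+oo]. *)
Definition dist_to (A : set X) (x : X) : \bar R :=
  ereal_inf [set edist_norm x y | y in A].

Definition strictly_inside (D A : set X) : Prop :=
  [/\ bounded_set A,
      A `<=` D &
      (0 < ereal_inf [set dist_to (frontier D) x | x in A])%E].

(* Supremum over [A] of a family of distances, in [0, +oo].  The point [0] is
   added only so that the supremum over the empty set is [0] and not [-oo]. *)
Definition sup_on (A : set X) (h : X -> \bar R) : \bar R :=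
  ereal_sup ([set 0%E] `|` [set h x | x in A]).

(* [dY] is the distance induced by the norm of the target space [Y]: below it
   is [edist_norm] for [Y = X], and [edist_op] for [Y = L(X)]. *)
Definition T_continuous (Y : Type) (dY : Y -> Y -> \bar R) (D : set X)
    (f : R -> X -> Y) : Prop :=
  forall (t0 : R) (A : set X), 0 <= t0 -> strictly_inside D A ->
    sup_on A (fun x => dY (f t x) (f t0 x))
      @[t --> within [set t | 0 <= t] (nbhs t0)] --> 0%E.

Definition jointly_continuous (D : set X) (f : R -> X -> X) : Prop :=
  {within [set t : R | 0 <= t] `*` D, continuous (fun p : R * X => f p.1 p.2)}.

(* A self-mapping of [D] is represented by a total map on [X] whose values
   outside [D] are irrelevant; likewise, a family indexed by t >= 0 is
   represented by a family indexed by [R]. *)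
Definition C0_selfmap (D : set X) (g : X -> X) : Prop :=
  (forall x, D x -> D (g x)) /\ {within D, continuous g}.

(* The Frechet differential as a map from [D] to L(X); it is K-linear over the
   scalar field K of [X], and [differentiable] includes its boundedness. *)
Definition frechet (g : X -> X) (x : X) : X -> X := 'd g x.

Definition C1_selfmap (D : set X) (g : X -> X) : Prop :=
  [/\ forall x, D x -> D (g x),
      forall x, D x -> differentiable g x &
      forall x0, D x0 ->
        edist_op (frechet g x) (frechet g x0)
          @[x --> within D (nbhs x0)] --> 0%E].

Record semigroup_on (D : set X) (F : R -> X -> X) : Prop := SemigroupOn {
  semigroup_selfmap : forall t, 0 <= t -> C0_selfmap D (F t);
  semigroup_joint : jointly_continuous D F;
  semigroup_add : forall t s', 0 <= t -> 0 <= s' ->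
    forall x, D x -> F (t + s') x = F t (F s' x);
  semigroup_lim0 : forall x, D x -> F t x @[t --> 0^'+] --> x
}.

Definition diff_quotient (F : R -> X -> X) (t : R) (x : X) : X :=
  scalar_of_real s t^-1 *: (F t x - x).

End Banach.

(* Main.v *)
(* Put G_t(x) = F_t(x) - x.  By the semigroup law,
   G_{t+u}(x) - G_t(x) - G_u(x) = G_t(F_u(x)) - G_t(x), and since the
   derivatives F_t' tend to the identity uniformly near a set A strictly inside
   D, the mean value inequality bounds this by e |G_u(x)| for all small t, u,
   uniformly in x in A.  A function of t >= 0 which is additive up to such an
   error satisfies |G_{nu} - n G_u| <= n e |G_u|.  With e = 1/2 and nu of the
   order of a fixed time this yields |G_u| <= M u; then e -> 0 shows that the
   quotients G_t / t are uniformly Cauchy on A. *)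
Require Import Defs.
From HB Require Import structures.
From mathcomp Require Import all_boot all_order all_algebra.
From mathcomp Require Import complex.
From mathcomp Require Import all_classical all_reals all_analysis.
From mathcomp Require Import lra.

Set Implicit Arguments.
Unset Strict Implicit.
Unset Printing Implicit Defensive.

Import Order.TTheory GRing.Theory Num.Theory.
Import numFieldNormedType.Exports.

Local Open Scope classical_set_scope.
Local Open Scope ring_scope.

(** * Real numbers inside the real or complex scalar field *)

Section ScalarTheory.
Context {R : realType} {s : scalars}.
Implicit Types (a b : R) (z : scalar_field R s).

Lemma scalar_of_realD a b :
  scalar_of_real s (a + b) = scalar_of_real s a + scalar_of_real s b.
Proof. by case: s => //=; rewrite rmorphD. Qed.

Lemma scalar_of_realM a b :
  scalar_of_real s (a * b) = scalar_of_real s a * scalar_of_real s b.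
Proof. by case: s => //=; rewrite rmorphM. Qed.

Lemma scalar_of_real0 : scalar_of_real s 0 = 0 :> scalar_field R s.
Proof. by case: s. Qed.

Lemma scalar_of_real1 : scalar_of_real s 1 = 1 :> scalar_field R s.
Proof. by case: s. Qed.

Lemma scalar_of_realN a : scalar_of_real s (- a) = - scalar_of_real s a.
Proof. by case: s => //=; rewrite rmorphN. Qed.

Lemma ler_scalar_of_real a b :
  (scalar_of_real s a <= scalar_of_real s b) = (a <= b).
Proof. by case: s => //=; rewrite lecR. Qed.

Lemma ltr_scalar_of_real a b :
  (scalar_of_real s a < scalar_of_real s b) = (a < b).
Proof. by case: s => //=; rewrite ltcR. Qed.

Lemma normr_scalar_of_real a : `|scalar_of_real s a| = scalar_of_real s `|a|.
Proof.
by case: s => //=; rewrite normc_def /= expr0n addr0 sqrtr_sqr.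
Qed.

Lemma scalar_of_realK : cancel (scalar_of_real s) (@real_of_scalar R s).
Proof. by case: s. Qed.

(** In [R[i]] the order forces a nonnegative element to have zero imaginary part, so taking the real
    part loses nothing. This lets every norm be handled in [R]. *)
Lemma ger0_real_of_scalarK z : 0 <= z ->
  scalar_of_real s (real_of_scalar s z) = z.
Proof. by case: s z => //= -[x y]; rewrite lecE /= => /andP[/eqP -> _]. Qed.

End ScalarTheory.

(** * The norm with values in [R], and the topology it induces *)

Section RealNorm.
Context {R : realType} {s : scalars}.
Variable X : completeNormedModType (scalar_field R s).
Implicit Types (x y : X) (a : R).

Lemma rnormE x : `|x| = scalar_of_real s (rnorm x).
Proof. by rewrite ger0_real_of_scalarK. Qed.

Lemma rnorm_ge0 x : 0 <= rnorm x.
Proof. by rewrite -(@ler_scalar_of_real R s) scalar_of_real0 -rnormE. Qed.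

Lemma rnorm0 : rnorm (0 : X) = 0.
Proof. by rewrite /rnorm normr0 -scalar_of_real0 scalar_of_realK. Qed.

Lemma rnormN x : rnorm (- x) = rnorm x.
Proof. by rewrite /rnorm normrN. Qed.

Lemma rdistC x y : rnorm (x - y) = rnorm (y - x).
Proof. by rewrite -rnormN opprB. Qed.

Lemma ler_rnormD x y : rnorm (x + y) <= rnorm x + rnorm y.
Proof.
by rewrite -(@ler_scalar_of_real R s) scalar_of_realD -!rnormE ler_normD.
Qed.

Lemma ler_rdistD y x z : rnorm (x - z) <= rnorm (x - y) + rnorm (y - z).
Proof. by rewrite -{1}(subrK y x) -addrA ler_rnormD. Qed.

Lemma rnormZ a x : rnorm (scalar_of_real s a *: x) = `|a| * rnorm x.
Proof.
apply: (can_inj (@scalar_of_realK R s)).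
by rewrite -rnormE normrZ normr_scalar_of_real scalar_of_realM -rnormE.
Qed.

Lemma rnorm_eq0 x : (rnorm x == 0) = (x == 0).
Proof.
rewrite -[RHS]normr_eq0 rnormE -scalar_of_real0.
by rewrite (can_eq (@scalar_of_realK R s)).
Qed.

(** Radii of balls are positive scalars, hence real, so radii taken in [R] describe the same
    neighbourhoods. *)
Lemma nbhs_rnormP x (P : set X) :
  nbhs x P <-> exists2 e : R, 0 < e & forall y, rnorm (x - y) < e -> P y.
Proof.
split=> [/nbhs_normP[e /= e0 eP]|[e e0 eP]].
  have eE := ger0_real_of_scalarK (ltW e0).
  exists (real_of_scalar s e).
    by rewrite -(@ltr_scalar_of_real R s) eE scalar_of_real0.
  by move=> y xy; apply: eP; rewrite /ball_ /= rnormE -eE ltr_scalar_of_real.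
apply/nbhs_normP; exists (scalar_of_real s e).
  by rewrite /= -scalar_of_real0 ltr_scalar_of_real.
by move=> y; rewrite /ball_ /= rnormE ltr_scalar_of_real; exact: eP.
Qed.

Lemma cvg_rnormP (T : Type) (G : set_system T) {FG : Filter G} (f : T -> X) y :
  f @ G --> y <-> forall e : R, 0 < e -> \forall t \near G, rnorm (f t - y) < e.
Proof.
split=> [fy e e0|fe].
  have : nbhs y [set z | rnorm (z - y) < e].
    by apply/nbhs_rnormP; exists e => // z /=; rewrite rdistC.
  by move/fy.
move=> P /nbhs_rnormP[e e0 eP].
by apply: filterS (fe e e0) => t te; apply: eP; rewrite rdistC.
Qed.

(** Completeness of [X] enters here. The centre [y] may change with [e], so no candidate for the
    limit is needed. *)
Lemma rnorm_cauchy_cvg (T : Type) (G : set_system T) {FG : ProperFilter G}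
    (f : T -> X) :
  (forall e : R, 0 < e -> exists y, \forall t \near G, rnorm (f t - y) < e) ->
  cvg (f @ G).
Proof.
move=> fc; apply: cauchy_cvg; apply: cauchy_exP => e e0.
have eE := ger0_real_of_scalarK (ltW e0).
have [|y fy] := fc (real_of_scalar s e).
  by rewrite -(@ltr_scalar_of_real R s) eE scalar_of_real0.
exists y; apply: filterS fy => t ty.
by rewrite -ball_normE /= distrC rnormE -eE ltr_scalar_of_real.
Qed.

End RealNorm.

(** * Uniform distances and their convergence to zero *)

Section SupOn.
Context {R : realType} {s : scalars}.
Variable X : completeNormedModType (scalar_field R s).
Implicit Types (A : set X) (h : X -> \bar R).

Lemma sup_on_ge0 A h : (0 <= sup_on A h)%E.
Proof. by apply: ereal_sup_ubound; left. Qed.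

Lemma le_sup_on A h x : A x -> (h x <= sup_on A h)%E.
Proof. by move=> Ax; apply: ereal_sup_ubound; right; exists x. Qed.

Lemma sup_on_le A h (e : \bar R) : (0 <= e)%E ->
  (forall x, A x -> (h x <= e)%E) -> (sup_on A h <= e)%E.
Proof.
by move=> e0 he; apply: ge_ereal_sup => _ [->|[x Ax <-]]; [|exact: he].
Qed.

(** The bound for [e = 1] makes [f] eventually finite, which reduces the claim to real convergence.
    The inequality is large because bounds on a supremum are. *)
Lemma cvge0P (T : Type) (G : set_system T) {FG : Filter G} (f : T -> \bar R) :
  (forall t, (0 <= f t)%E) ->
  f @ G --> 0%E <-> forall e : R, 0 < e -> \forall t \near G, (f t <= e%:E)%E.
Proof.
move=> f0; split=> [f_cvg e e0|fe].
  have /f_cvg fe : nbhs 0%E [set y : \bar R | (y < e%:E)%E].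
    by apply: open_ereal_lt'; rewrite lte_fin.
  by apply: (@filterS _ G _ _ _ _ fe) => t /ltW.
apply/fine_cvgP; split.
  apply: filterS (fe 1 ltr01) => t t1.
  by rewrite ge0_fin_numE// (le_lt_trans t1)// ltry.
apply/cvgrPdist_le => e e0; apply: filterS (fe e e0) => t te.
rewrite sub0r normrN /= ger0_norm ?fine_ge0// -lee_fin fineK//.
by rewrite ge0_fin_numE// (le_lt_trans te)// ltry.
Qed.

Lemma T_continuous0 (Y : Type) (dY : Y -> Y -> \bar R) (D A : set X)
    (f : R -> X -> Y) (e : R) :
  T_continuous dY D f -> strictly_inside D A -> 0 < e ->
  exists2 d : R, 0 < d & forall t x, 0 <= t < d -> A x ->
    (dY (f t x) (f 0%R x) <= e%:E)%E.
Proof.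
move=> fT DA e0.
have /cvge0P fe := fT 0%R A (lexx 0) DA.
have /nbhs_ballP[d /= d0 dP] := fe (fun=> sup_on_ge0 _ _) e e0.
exists d => // t x /andP[t0 td] Ax.
apply: le_trans (le_sup_on _ Ax) (dP t _ t0).
by rewrite /ball /= sub0r normrN ger0_norm.
Qed.

End SupOn.

(** * Pointwise bounds from the operator norm *)

Section OpNorm.
Context {R : realType} {s : scalars}.
Variable X : completeNormedModType (scalar_field R s).

(** For [v != 0], the normalised vector competes in the supremum; homogeneity gives the rest. *)
Lemma opnorm_bound (L : {linear X -> X}) (e : R) v :
  (opnorm L <= e%:E)%E -> rnorm (L v) <= e * rnorm v.
Proof.
move=> Le; have [->|v0] := eqVneq v 0.
  by rewrite linear0 rnorm0 mulr0.
have nv : 0 < rnorm v by rewrite lt_def rnorm_eq0 v0 rnorm_ge0.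
have nv0 : 0 <= (rnorm v)^-1 by rewrite invr_ge0 rnorm_ge0.
rewrite -ler_pdivrMr// mulrC -[(rnorm v)^-1]ger0_norm//.
rewrite -rnormZ -linearZZ -lee_fin; apply: le_trans Le.
apply: ereal_sup_ubound; exists (scalar_of_real s (rnorm v)^-1 *: v) => //=.
by rewrite rnormZ ger0_norm// mulVf// gt_eqF.
Qed.

End OpNorm.

(* Induction on [0, 1]: [P] reaches 1 since [sup {t | P t}] cannot be
   smaller. *)
Lemma unit_interval_ind {R : realType} (P : R -> Prop) :
  P 0 ->
  (forall t, 0 <= t <= 1 -> exists2 d, 0 < d &
    forall u v, 0 <= u -> t - d < u -> u <= t -> t <= v -> v < t + d ->
      v <= 1 -> P u -> P v) ->
  P 1.
Proof.
move=> P0 Pstep; pose S := [set t | 0 <= t <= 1 /\ P t].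
have S0 : S 0 by split; rewrite ?lexx ?ler01.
have S1 : ubound S 1 by move=> t [/andP[]].
have supS : has_sup S by split; [exists 0|exists 1].
have m0 : 0 <= sup S by apply: ub_le_sup => //; exists 1.
have m1 : sup S <= 1 by apply: ge_sup => //; exists 0.
have [|d d0 dP] := Pstep (sup S); first by rewrite m0.
have [u [/andP[u0 u1] Pu] mu] := sup_adherent d0 supS.
have um : u <= sup S by apply: ub_le_sup => //; [exists 1|split => //; apply/andP].
have [le1|lt1] := leP 1 (sup S + d / 2).
  by apply: (dP u) => //; lra.
have : S (sup S + d / 2).
  split; first by apply/andP; split; lra.
  by apply: (dP u) => //; lra.
move=> /(ub_le_sup (ex_intro _ 1 S1)); lra.
Qed.

Lemma subrACA (V : zmodType) (a b c d : V) :
  (a - b) - (c - d) = (a - c) - (b - d).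
Proof. by rewrite !opprB addrACA [RHS]addrACA [- b - c]addrC. Qed.

(** * The mean value inequality along a segment *)

Section MeanValue.
Context {R : realType} {s : scalars}.
Variable X : completeNormedModType (scalar_field R s).
Implicit Types (x y v : X) (g : X -> X) (L : {linear X -> X}).

Local Notation segment x v t := (x + scalar_of_real s t *: v).

Lemma segmentB x v t u : segment x v u - segment x v t =
  scalar_of_real s (u - t) *: v.
Proof.
by rewrite opprD addrACA subrr add0r scalar_of_realD scalar_of_realN scalerBl.
Qed.

Lemma differentiable_rnorm g x : differentiable g x ->
  forall e : R, 0 < e -> exists2 d : R, 0 < d & forall y, rnorm (y - x) < d ->
    rnorm (g y - g x - 'd g x (y - x)) <= e * rnorm (y - x).
Proof.
move=> /diff_locallyP[_ /eqaddoP gx] e e0.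
have /gx : 0 < scalar_of_real s e.
  by rewrite -scalar_of_real0 ltr_scalar_of_real.
move=> /nbhs_rnormP[d d0 dP]; exists d => // y yx.
have := dP (y - x); rewrite sub0r rnormN => /(_ yx) /=.
rewrite !fctE /= subrK !rnormE -scalar_of_realM ler_scalar_of_real.
by rewrite opprD addrA.
Qed.

(** Along the segment, [g - L] has a derivative bounded by [e]. Around each parameter this gives a
    Lipschitz estimate of slope [e + a] with [a] arbitrarily small, and [unit_interval_ind] chains
    these estimates from 0 to 1. *)
Lemma mean_value_le g L x y (e : R) : 0 <= e ->
  (forall t, 0 <= t <= 1 -> differentiable g (segment x (y - x) t)) ->
  (forall t v, 0 <= t <= 1 ->
    rnorm ('d g (segment x (y - x) t) v - L v) <= e * rnorm v) ->
  rnorm (g y - g x - L (y - x)) <= e * rnorm (y - x).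
Proof.
move=> e0 gd gL; apply/ler_addgt0Pr => eta eta0.
have nv := rnorm_ge0 (y - x).
(* The excess slope [a] costs at most [eta] over the whole segment; the [+ 1] covers the case
   [x = y]. *)
pose a := eta / (rnorm (y - x) + 1).
have a0 : 0 < a by rewrite divr_gt0// ltr_wpDl.
have aE : a * rnorm (y - x) <= eta.
  rewrite /a mulrAC -mulrA ler_piMr ?(ltW eta0)// ler_pdivrMr ?ltr_wpDl//.
  by rewrite mul1r lerDl.
set v := y - x in gd gL nv aE *.
pose G t := g (segment x v t) - L (segment x v t).
suff : rnorm (G 1 - G 0) <= (e + a) * rnorm v * 1.
  rewrite /G scalar_of_real0 scalar_of_real1 scale0r scale1r addr0 /v.
  rewrite [x + _]addrC subrK subrACA -linearB -/v mulr1 mulrDl => /le_trans.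
  by apply; rewrite lerD2l.
apply: (@unit_interval_ind R
  (fun t => rnorm (G t - G 0) <= (e + a) * rnorm v * t)).
  by rewrite subrr rnorm0 mulr0.
have Gstep t : 0 <= t <= 1 -> exists2 d : R, 0 < d & forall u, `|u - t| < d ->
    rnorm (G u - G t) <= (e + a) * rnorm v * `|u - t|.
  move=> t01; have [d d0 dP] := differentiable_rnorm (gd t t01) a0.
  exists (d / (rnorm v + 1)); first by rewrite divr_gt0// ltr_wpDl.
  move=> u ud; set p := segment x v t; set q := segment x v u.
  have qp : q - p = scalar_of_real s (u - t) *: v by exact: segmentB.
  have nqp : rnorm (q - p) = `|u - t| * rnorm v by rewrite qp rnormZ.
  have qpd : rnorm (q - p) < d.
    rewrite nqp; move: ud; rewrite ltr_pdivlMr ?ltr_wpDl//.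
    by apply: le_lt_trans; rewrite ler_wpM2l// lerDl.

  (* First-order remainder of [g] at [p], plus the deviation of its differential from [L]. *)
  have -> : G u - G t =
      (g q - g p - 'd g p (q - p)) + ('d g p (q - p) - L (q - p)).
    by rewrite /G subrACA -linearB addrA subrK.
  apply: le_trans (ler_rnormD _ _) _.
  rewrite -mulrA [rnorm v * _]mulrC -nqp mulrDl [e * _ + _]addrC lerD//.
    exact: dP.
  exact: gL.
(* The local estimate only compares with the centre [t], so the increment from [u] to [w] is split
   at [t], which lies between them. *)
move=> t t01; have [d d0 dP] := Gstep t t01; exists d => // u w u0 tu ut tw wt _.
have Gu : rnorm (G t - G u) <= (e + a) * rnorm v * (t - u).
  have := dP u; rewrite rdistC distrC ger0_norm ?subr_ge0//; apply; lra.
have Gw : rnorm (G w - G t) <= (e + a) * rnorm v * (w - t).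
  have := dP w; rewrite ger0_norm ?subr_ge0//; apply; lra.
have h1 := ler_rdistD (G t) (G w) (G u).
have h2 := ler_rdistD (G u) (G w) (G 0).
lra.
Qed.

End MeanValue.

(** * Sets strictly inside an open set *)

Section StrictlyInside.
Context {R : realType} {s : scalars}.
Variable X : completeNormedModType (scalar_field R s).
Implicit Types (D A : set X) (x y p : X).

Lemma bounded_set_rnormP A :
  bounded_set A <-> exists M : R, forall x, A x -> rnorm x <= M.
Proof.
split=> [[M [Mreal MA]]|[M MA]].
  have M1 : M < `|M| + 1 by rewrite (le_lt_trans (real_ler_norm Mreal))// ltrDl.
  exists (real_of_scalar s (`|M| + 1)) => x Ax.
  rewrite -(@ler_scalar_of_real R s) ger0_real_of_scalarK ?addr_ge0//.
  by rewrite -rnormE; exact: MA Ax.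
exists (scalar_of_real s M); split.
  have := num_real M; rewrite !realE -[0 in X in _ -> X](@scalar_of_real0 R s).
  by rewrite !ler_scalar_of_real.
move=> N MN x Ax /=; apply: le_trans (ltW MN).
by rewrite rnormE ler_scalar_of_real; exact: MA.
Qed.

Lemma strictly_insideP D A :
  strictly_inside D A <->
  [/\ exists M : R, forall x, A x -> rnorm x <= M, A `<=` D &
      exists2 r : R, 0 < r &
        forall x p, A x -> frontier D p -> r <= rnorm (x - p)].
Proof.
split=> [[/bounded_set_rnormP Ab AD Ad]|[Ab AD [r r0 rA]]]; split=> //.
- have [r r0 rd] : exists2 r : R, 0 < r &
      (r%:E <= ereal_inf [set dist_to (frontier D) x | x in A])%E.
    case: (ereal_inf _) Ad => [a||]//; first by rewrite lte_fin => a0; exists a.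
    (* The infimum is [+oo], as for an empty frontier: any positive radius will do. *)
    by exists 1 => //; rewrite leey.
  exists r => // x p Ax Dp; rewrite -lee_fin; apply: le_trans rd _.
  apply: (@le_trans _ _ (dist_to (frontier D) x)).
    by apply: ereal_inf_lbound; exists x.
  by apply: ereal_inf_lbound; exists p.
- exact/bounded_set_rnormP.
- apply: (@lt_le_trans _ _ r%:E); first by rewrite lte_fin.
  apply: le_ereal_inf_tmp => _ [x Ax <-].
  by apply: le_ereal_inf_tmp => _ [p Dp <-]; rewrite lee_fin rA.
Qed.

(** Through singletons, uniform statements specialise to pointwise ones. *)
Lemma strictly_inside1 D x : open D -> D x -> strictly_inside D [set x].
Proof.
move=> oD Dx; apply/strictly_insideP; split; first by exists (rnorm x) => _ ->.
  by move=> _ ->.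
have /nbhs_rnormP[r r0 rD] : nbhs x D by exact: open_nbhs_nbhs.
exists r => // _ p -> [_ Dp]; rewrite leNgt; apply/negP => /rD.
by move: Dp; rewrite (interior_id D).1.
Qed.

(* A segment leaving the open set [D] meets its frontier. *)
Lemma frontier_avoiding_ball D x (r : R) : open D -> D x ->
  (forall p, frontier D p -> r <= rnorm (x - p)) ->
  forall y, rnorm (y - x) < r -> D y.
Proof.
move=> oD Dx rD y yx; have nv := rnorm_ge0 (y - x).
pose p t := x + scalar_of_real s t *: (y - x).
have -> : y = p 1 by rewrite /p scalar_of_real1 scale1r addrC subrK.
apply: (@unit_interval_ind R (fun t => D (p t))).
  by rewrite /p scalar_of_real0 scale0r addr0.
move=> t /andP[t0 t1].
have near_pt (V : set X) : nbhs (p t) V -> exists2 d : R, 0 < d &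
    forall u, `|t - u| < d -> V (p u).
  move=> /nbhs_rnormP[e e0 eV]; exists (e / (rnorm (y - x) + 1)).
    by rewrite divr_gt0// ltr_wpDl.
  move=> u; rewrite ltr_pdivlMr ?ltr_wpDl// => ue; apply: eV.
  rewrite /p segmentB rnormZ; apply: le_lt_trans ue.
  by rewrite ler_wpM2l// lerDl.
have [Dpt|nDpt] := pselect (D (p t)).
  have [|d d0 dD] := near_pt D; first exact: open_nbhs_nbhs.
  by exists d => // u v _ _ _ tv vd _ _; apply: dD; rewrite ltr_norml; lra.
(* If [p t] is outside [D], it is outside [closure D] too, since it is closer to [x] than any
   frontier point may be. Nearby earlier points then miss [D], contradicting [D (p u)]. *)
have [|d d0 dD] := near_pt (~` closure D).
  apply: open_nbhs_nbhs; split; first exact/closed_openC/closed_closure.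
  move=> cDpt; have := rD (p t); rewrite leNgt => /(_ _)/negP; apply.
    by split=> //; rewrite (interior_id D).1.
  rewrite /p opprD addNKr rnormN rnormZ ger0_norm//.
  by apply: le_lt_trans yx; rewrite ler_piMl.
exists d => // u v _ tu ut _ _ _ Du; exfalso.
by apply: (dD u); [rewrite ltr_norml; lra|exact: subset_closure].
Qed.

Definition thickening A (r : R) : set X :=
  [set y | exists2 x, A x & rnorm (y - x) <= r].

(** Half of the distance to the frontier is spent on the thickening, and the other half remains as a
    margin. Short segments issued from [A] thus stay strictly inside [D]. *)
Lemma strictly_inside_thickening D A : open D -> strictly_inside D A ->
  exists2 r : R, 0 < r & strictly_inside D (thickening A r).
Proof.
move=> oD /strictly_insideP[[M MA] AD [r r0 rA]].
have r20 : 0 < r / 2 by rewrite divr_gt0.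
exists (r / 2) => //; apply/strictly_insideP; split.
- exists (r / 2 + M) => y [x Ax yx]; rewrite -(subrK x y).
  by apply: le_trans (ler_rnormD _ _) _; rewrite lerD// MA.
- move=> y [x Ax yx].
  apply: (frontier_avoiding_ball oD (AD x Ax) (fun p => rA x p Ax)).
  by apply: le_lt_trans yx _; lra.
- exists (r / 2) => // y p [x Ax yx] Dp.
  have := ler_rdistD y x p; rewrite [rnorm (x - y)]rdistC.
  have := rA x p Ax Dp; lra.
Qed.

End StrictlyInside.

(** * Functions of time that are additive up to a small relative error *)

Section AlmostAdditive.
Context {R : realType} {s : scalars}.
Variable X : completeNormedModType (scalar_field R s).
Implicit Types (G : R -> X) (e T t u w M : R).

(** The error is relative to [G u] alone, which is the form the mean value inequality produces. Only
    the summands are kept below [T]; their sum may exceed it. *)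
Definition almost_additive G e T :=
  G 0 = 0 /\
  forall t u, 0 <= t < T -> 0 <= u < T ->
    rnorm (G (t + u) - G t - G u) <= e * rnorm (G u).

(** Each of the [n] increments by [u] costs one error [e * rnorm (G u)]. *)
Lemma almost_additive_mulrn G e T u n : almost_additive G e T ->
  0 <= u -> n%:R * u < T ->
  rnorm (G (n%:R * u) - scalar_of_real s n%:R *: G u) <= n%:R * e * rnorm (G u).
Proof.
move=> [G0 GD] u0; elim: n => [_|n IHn].
  by rewrite !mul0r G0 scalar_of_real0 scale0r subrr rnorm0.
rewrite -natr1 !mulrDl !mul1r => nT.
have nu0 : 0 <= n%:R * u by rewrite mulr_ge0.
have IH := IHn ltac:(lra).
have step := GD (n%:R * u) u ltac:(lra) ltac:(lra).
rewrite scalar_of_realD scalar_of_real1 scalerDl scale1r.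
rewrite [_ + e * _]addrC; apply: le_trans (lerD step IH).
apply: le_trans (ler_rnormD _ _); rewrite le_eqVlt; apply/orP; left.
apply/eqP; congr rnorm; rewrite opprD addrA [RHS]addrAC.
by congr (_ - _); rewrite addrA subrK.
Qed.

Lemma almost_additive_linear_bound G T u : 0 < T ->
  almost_additive G 2^-1 T -> (forall t, 0 <= t < T -> rnorm (G t) <= 1) ->
  0 <= u < T / 4 -> rnorm (G u) <= 8 / T * u.
Proof.
move=> T0 GD G1 /andP[]; rewrite le_eqVlt => /predU1P[<- _|u0 uT].
  by rewrite GD.1 rnorm0 mulr0.
have /truncn_itv/andP[] : 0 <= T / 2 / u by rewrite !divr_ge0// ltW.
(* [n] is the largest integer with [n * u <= T / 2], so [u < T / 4] forces [n * u > T / 4]. With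
   error 1/2, [rnorm (G (n * u)) <= 1] yields [n * rnorm (G u) <= 2], whence the factor [8 / T]. *)
set n := Num.trunc _; rewrite ler_pdivlMr// ltr_pdivrMr// -[n.+1%:R]natr1 mulrDl mul1r.
move=> nT Tn.
have nu : T / 4 < n%:R * u by lra.
have nuT : n%:R * u < T by lra.
have := almost_additive_mulrn GD (ltW u0) nuT.
have := G1 (n%:R * u) ltac:(lra).
have := ler_rnormD (G (n%:R * u))
  (- (G (n%:R * u) - scalar_of_real s n%:R *: G u)).
rewrite rnormN opprB addrC subrK rnormZ ger0_norm//.
have g0 := rnorm_ge0 (G u); move: (rnorm (G u)) g0 => g g0 h1 h2 h3.
have h4 : n%:R * g <= 2 by lra.
rewrite mulrAC ler_pdivlMr//.
have : T / 4 * g <= n%:R * u * g by rewrite ler_wpM2r// ltW.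
have : n%:R * g * u <= 2 * u by rewrite ler_wpM2r// ltW.
lra.
Qed.

(** Write [t = n * u + w] with [n] the integer part of [t / u]. Splitting off [w], the value [G w]
    and rounding [t / u] to [n] cost at most [M * u] each; the [n] increments cost [M * e * t]
    together. *)
Lemma almost_additive_ratio G e T M t u : 0 <= e <= 1 ->
  almost_additive G e T -> (forall w, 0 <= w < T -> rnorm (G w) <= M * w) ->
  0 < u -> u <= t -> t < T ->
  rnorm (G t - scalar_of_real s (t / u) *: G u) <= M * (3 * u + e * t).
Proof.
move=> /andP[e0 e1] GD GM u0 ut tT.
have /truncn_itv/andP[] : 0 <= t / u by rewrite divr_ge0 ?ltW// (lt_le_trans u0).
set n := Num.trunc _ => nt tn.
have nut : n%:R * u <= t by rewrite -ler_pdivlMr.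
have tnu : t < n%:R * u + u by rewrite -{2}[u]mul1r -mulrDl natr1 -ltr_pdivrMr.
have nu0 : 0 <= n%:R * u by rewrite mulr_ge0// ltW.
pose w := t - n%:R * u.
have h1 := GD.2 (n%:R * u) w ltac:(lra) ltac:(rewrite /w; lra).
rewrite [X in G X - _ - _](_ : _ = t) in h1; last by rewrite /w addrC subrK.
have h2 := GM w ltac:(rewrite /w; lra).
have h3 := almost_additive_mulrn GD (ltW u0) (le_lt_trans nut tT).
have h4 := GM u ltac:(lra).
have h5 : rnorm (scalar_of_real s (n%:R - t / u) *: G u) <= rnorm (G u).
  rewrite rnormZ ler_piMl ?rnorm_ge0// ler_norml; rewrite -natr1 in tn; lra.
have M0 : 0 <= M by have := rnorm_ge0 (G u); have := h4; nra.
have -> : G t - scalar_of_real s (t / u) *: G u =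
    (G t - G (n%:R * u) - G w) + G w +
    ((G (n%:R * u) - scalar_of_real s n%:R *: G u) +
     scalar_of_real s (n%:R - t / u) *: G u).
  rewrite subrK scalar_of_realD scalar_of_realN scalerBl.
  by rewrite [_ - _ *: _ + _]addrA subrK addrA subrK.
apply: le_trans (ler_rnormD _ _) _.
apply: le_trans (lerD (ler_rnormD _ _) (ler_rnormD _ _)) _.
have wu : w <= u by rewrite /w; lra.
have k1 : e * rnorm (G w) <= rnorm (G w) by rewrite ler_piMl// rnorm_ge0.
have k2 : M * w <= M * u by rewrite ler_wpM2l.
have k3 : n%:R * e * rnorm (G u) <= M * (e * t).
  apply: (@le_trans _ _ (n%:R * e * (M * u))); first by rewrite ler_wpM2l ?mulr_ge0.
  have : M * e * (n%:R * u) <= M * e * t by rewrite ler_wpM2l ?mulr_ge0.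
  lra.
lra.
Qed.

(** Both quotients are compared with the one at a common, much smaller time [u]; each comparison
    costs [2 * M * e]. *)
Lemma almost_additive_quotient G e T M t w : 0 < e <= 1 ->
  almost_additive G e T -> (forall v, 0 <= v < T -> rnorm (G v) <= M * v) ->
  0 < t < T -> 0 < w < T ->
  rnorm (scalar_of_real s t^-1 *: G t - scalar_of_real s w^-1 *: G w)
    <= 4 * M * e.
Proof.
move=> /andP[e0 e1] GD GM tT wT.
have M0 : 0 <= M.
  move/andP: tT => [t0 tT].
  rewrite -(pmulr_lge0 _ t0) (le_trans (rnorm_ge0 (G t)))// GM//; lra.
have quotient u v : 0 < v < T -> 0 < u -> 3 * u <= e * v ->
    rnorm (scalar_of_real s v^-1 *: G v - scalar_of_real s u^-1 *: G u)
      <= 2 * M * e.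
  move=> /andP[v0 vT] u0 uv.
  have -> : u^-1 = v^-1 * (v / u) by rewrite mulrA mulVf ?gt_eqF// mul1r.
  rewrite scalar_of_realM -scalerA -scalerBr rnormZ.
  rewrite ger0_norm ?invr_ge0 ?(ltW v0)// mulrC ler_pdivrMr//.
  have ev : e * v <= v by rewrite ler_piMl// ltW.
  have e01 : 0 <= e <= 1 by rewrite ltW.
  apply: le_trans (almost_additive_ratio e01 GD GM u0 _ vT) _; first by lra.
  have : M * (3 * u) <= M * (e * v) by rewrite ler_wpM2l.
  lra.
(* Small enough for the term [3 * u] of [almost_additive_ratio] to be absorbed by [e * t] and by
   [e * w]. *)
pose u := e * Num.min t w / 3.
have m0 : 0 < Num.min t w by rewrite lt_min; lra.
have u0 : 0 < u by rewrite divr_gt0// mulr_gt0.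
have uE : 3 * u = e * Num.min t w by rewrite /u mulrC divfK.
have ut : 3 * u <= e * t by rewrite uE (ler_wpM2l (ltW e0))// ge_min lexx.
have uw : 3 * u <= e * w by rewrite uE (ler_wpM2l (ltW e0))// ge_min lexx orbT.
apply: le_trans (ler_rdistD (scalar_of_real s u^-1 *: G u) _ _) _.
have := quotient u t tT u0 ut; have := quotient u w wT u0 uw.
by rewrite [rnorm (_ w^-1 *: _ - _)]rdistC; lra.
Qed.

End AlmostAdditive.

Lemma near_right0 {R : realType} (P : R -> Prop) (d : R) : 0 < d ->
  (forall t, 0 < t < d -> P t) -> \forall t \near 0^'+, P t.
Proof.
move=> d0 dP; apply: filterS (filterI (nbhs_right_gt 0) (nbhs_right_lt d0)).
by move=> t [t0 td]; apply: dP; apply/andP.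
Qed.

(** * Difference quotients of the semigroup *)

Section Semigroup.
Context {R : realType} {s : scalars}.
Variable X : completeNormedModType (scalar_field R s).
Variables (D : set X) (F : R -> X -> X).
Hypotheses (D_open : open D) (F_semigroup : semigroup_on D F).
Hypothesis F_C1 : forall t, 0 <= t -> C1_selfmap D (F t).
Hypothesis F_Tcont : T_continuous (@edist_norm R s X) D F.
Hypothesis dF_Tcont : T_continuous (@edist_op R s X) D (fun t => frechet (F t)).

(** As [t] decreases to 0, [F t x] tends to [F 0 x] by T-continuity and to [x] by the semigroup
    axiom. *)
Lemma semigroup0 x : D x -> F 0 x = x.
Proof.
move=> Dx; apply/eqP; rewrite -subr_eq0 -rnorm_eq0 eq_le rnorm_ge0 andbT.
apply/ler_addgt0Pr => e e0; rewrite add0r.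
have e20 : 0 < e / 2 by rewrite divr_gt0.
have [d d0 dP] := T_continuous0 F_Tcont (strictly_inside1 D_open Dx) e20.
have /cvg_rnormP/(_ _ e20) Fx := semigroup_lim0 F_semigroup Dx.
have td : \forall t \near 0^'+, 0 <= t < d.
  by apply: (near_right0 d0) => t /andP[/ltW -> ->].
have [t [xt td']] := @filter_ex _ _ (at_right_proper_filter 0) _ (filterI Fx td).
have := dP t x td' erefl; rewrite lee_fin => Ft.
apply: le_trans (ler_rdistD (F t x) _ _) _.
by rewrite rdistC; lra.
Qed.

(** [F 0] is known to be the identity only on [D]; openness of [D] makes this enough for
    derivatives. *)
Lemma frechet_semigroup0 x v : D x -> frechet (F 0) x v = v.
Proof.
move=> Dx; have [_ dF _] := F_C1 (lexx 0).
rewrite /frechet -(deriveE _ (dF x Dx)).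
rewrite (near_eq_derive (g := id)) ?derive_id//.
by apply: filterS (open_nbhs_nbhs (conj D_open Dx)) => y; exact: semigroup0.
Qed.

Lemma semigroup_almost_additive A (e : R) : strictly_inside D A -> 0 < e ->
  exists2 T : R, 0 < T & forall x, A x ->
    almost_additive (fun t => F t x - x) e T /\
    forall t, 0 <= t < T -> rnorm (F t x - x) <= 1.
Proof.
move=> DA e0; have [r r0 DB] := strictly_inside_thickening D_open DA.
have [_ AD _] := DA; have [_ BD _] := DB.
(* The bound [r] keeps the segment from [x] to [F u x] in the thickening; the bound 1 is the one
   [almost_additive_linear_bound] asks for. *)
have m0 : 0 < Num.min r 1 by rewrite lt_min r0 ltr01.
have [d1 d10 Fd1] := T_continuous0 F_Tcont DA m0.
have [d2 d20 dFd2] := T_continuous0 dF_Tcont DB e0.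
exists (Num.min d1 d2); first by rewrite lt_min d10.
move=> x Ax; have Dx := AD x Ax.
have Fx t : 0 <= t < Num.min d1 d2 -> rnorm (F t x - x) <= Num.min r 1.
  move=> /andP[t0]; rewrite lt_min => /andP[td1 _].
  have := Fd1 t x; rewrite /edist_norm semigroup0// lee_fin; apply=> //.
  by rewrite t0.
split; last by move=> t /Fx; rewrite le_min => /andP[].
split; first by rewrite semigroup0 ?subrr.
move=> t u /andP[t0 +] uT; rewrite lt_min => /andP[_ td2].
have u0 : 0 <= u by case/andP: uT.
rewrite (semigroup_add F_semigroup)//.
set y := F u x; have yr : rnorm (y - x) <= r.
  by have := Fx u uT; rewrite le_min => /andP[].
have seg a : 0 <= a <= 1 ->
    thickening A r (x + scalar_of_real s a *: (y - x)).
  move=> /andP[a0 a1]; exists x => //.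
  rewrite addrC addKr rnormZ ger0_norm//; apply: le_trans yr.
  by rewrite ler_piMl// rnorm_ge0.
(* This is the shape of the mean value inequality for [F t] between [x] and [y], with the identity
   as [L]. *)
have -> : F t y - x - (F t x - x) - (y - x) = F t y - F t x - (y - x).
  by rewrite [F t y - x - _]subrACA subrr subr0.
have [_ dF _] := F_C1 t0.
apply: (@mean_value_le _ _ _ (F t) idfun) => [|a a01|a v a01].
- exact: ltW.
- by apply: dF; apply: BD; exact: seg.
- have Bp := seg a a01; set p := x + _ in Bp *.
  have := dFd2 t p; rewrite t0 td2 => /(_ erefl Bp) dFp.
  have v0 : v = 'd (F 0) p v.
    by rewrite -[RHS]/(frechet (F 0) p v) frechet_semigroup0//; exact: BD.
  rewrite /= [X in _ - X]v0.
  exact: (@opnorm_bound _ _ _ ('d (F t) p \- 'd (F 0) p)).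
Qed.

Lemma diff_quotient_cauchy A (e : R) : strictly_inside D A -> 0 < e ->
  exists2 d : R, 0 < d & forall x t w, A x -> 0 < t < d -> 0 < w < d ->
    rnorm (diff_quotient F t x - diff_quotient F w x) <= e.
Proof.
move=> DA e0.
have h0 : (0 : R) < 2^-1 by rewrite invr_gt0.
have [T T0 GT] := semigroup_almost_additive DA h0.
pose M := 8 / T; have M0 : 0 < M by rewrite divr_gt0.
(* The second error level: at most 1 as [almost_additive_quotient] requires, and with
   [4 * M * a <= e]. *)
pose a := Num.min 1 (e / (4 * M)).
have a0 : 0 < a by rewrite lt_min ltr01 divr_gt0// mulr_gt0.
have a1 : 0 < a <= 1 by rewrite a0 /a ge_min lexx.
have Ma : 4 * M * a <= e.
  have M4 : 0 < 4 * M by rewrite mulr_gt0.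
  by rewrite mulrC -(ler_pdivlMr _ _ M4) /a ge_min lexx orbT.
have [S S0 GS] := semigroup_almost_additive DA a0.
(* Below [S] the additivity error is [a]; below [T / 4] the linear bound with constant [M] holds.
   Neither depends on [x]. *)
exists (Num.min S (T / 4)); first by rewrite lt_min S0 divr_gt0.
move=> x t w Ax tS wS; apply: le_trans Ma.
have [G12 G1] := GT x Ax; have [[G0 Ga] _] := GS x Ax.
have Ga' : almost_additive (fun t => F t x - x) a (Num.min S (T / 4)).
  split=> // u v; rewrite !lt_min.
  by move=> /and3P[u0 uS _] /and3P[v0 vS _]; apply: Ga; apply/andP.
have GM v : 0 <= v < Num.min S (T / 4) -> rnorm (F v x - x) <= M * v.
  rewrite lt_min => /and3P[v0 _ vT].
  by apply: (almost_additive_linear_bound T0 G12 G1); apply/andP.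
exact: (almost_additive_quotient a1 Ga' GM tS wS).
Qed.

End Semigroup.

Theorem theorem4p1 (R : realType) (s : scalars)
    (X : completeNormedModType (scalar_field R s))
    (D : set X) (F : R -> X -> X)
    (D_domain : domain D)
    (F_semigroup : semigroup_on D F)
    (F_C1 : forall t : R, 0 <= t -> C1_selfmap D (F t))
    (F_Tcont : T_continuous (@edist_norm R s X) D F)
    (dF_Tcont : T_continuous (@edist_op R s X) D (fun t => frechet (F t))) :
  exists f : X -> X,
    (forall x, D x -> diff_quotient F t x @[t --> 0^'+] --> f x) /\
    (forall A : set X, strictly_inside D A ->
       sup_on A (fun x => edist_norm (diff_quotient F t x) (f x))
         @[t --> 0^'+] --> 0%E).
Proof.
have oD := D_domain.1.
have cauchyA := diff_quotient_cauchy oD F_semigroup F_C1 F_Tcont dF_Tcont.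
(* Convergence is only claimed on [D]; elsewhere this [lim] may be a default value. *)
pose f x := lim (diff_quotient F t x @[t --> 0^'+]).
have f_cvg x : D x -> diff_quotient F t x @[t --> 0^'+] --> f x.
  move=> Dx; apply: rnorm_cauchy_cvg => e e0.
  have e20 : 0 < e / 2 by rewrite divr_gt0.
  have [d d0 dP] := cauchyA _ _ (strictly_inside1 oD Dx) e20.
  have d20 : 0 < d / 2 < d by lra.
  exists (diff_quotient F (d / 2) x); apply: (near_right0 d0) => t td.
  by apply: le_lt_trans (dP x t (d / 2) erefl td d20) _; lra.
exists f; split=> // A DA; apply/cvge0P => [t|e e0]; first exact: sup_on_ge0.
have e20 : 0 < e / 2 by rewrite divr_gt0.
have [d d0 dP] := cauchyA _ _ DA e20; have [_ AD _] := DA.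
apply: (near_right0 d0) => t td; apply: sup_on_le => [|x Ax].
  by rewrite lee_fin ltW.
(* The auxiliary time [w] may depend on [x], but [d] does not, so the resulting bound is uniform on
   [A]. *)
have /cvg_rnormP/(_ _ e20) fx := f_cvg x (AD x Ax).
have [w [fw wd]] := @filter_ex _ _ (at_right_proper_filter 0) _
  (filterI fx (near_right0 d0 (fun=> id))).
rewrite lee_fin; apply: le_trans (ler_rdistD (diff_quotient F w x) _ _) _.
have := dP x t w Ax td wd; lra.
Qed.
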